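(* Let $(\rho_h,m_h)$ be a solution on $[0,T]$ of the semi-discrete problem (S) defined in the context, with initial values $\rho_{0,h},m_{0,h}$. Then, for all $t\in[0,T]$, $$\int_{\mathcal E}\rho_h(t)\,dx=\int_{\mathcal E}\rho_{0,h}\,dx$$ and $$\int_{\mathcal E}\Big(\frac{m_h(t)^2}{2\rho_h(t)}+P(\rho_h(t))\Big)dx+\int_0^t\int_{\mathcal E}\Big(a\frac{|\partial_x'm_h(s)|^2}{|\rho_h(s)|^2}+b\frac{|m_h(s)|^3}{|\rho_h(s)|^2}\Big)dx\,ds=\int_{\mathcal E}\Big(\frac{m_{0,h}^2}{2\rho_{0,h}}+P(\rho_{0,h})\Big)dx.$$
   Context: Network. $\mathcal G=(\mathcal V,\mathcal E,\ell)$ is a finite, directed, connected graph with vertex set $\mathcal V$, edge set $\mathcal E\subset\mathcal V\times\mathcal V$, and lengths $\ell_e>0$, $e\in\mathcal E$. An edge $e=(v_1,v_2)$ is identified with the interval $[0,\ell_e]$ ($v_1$ corresponding to $0$, $v_2$ to $\ell_e$), and $n_e(v_1)=-1$, $n_e(v_2)=1$. $\mathcal E(v)$ is the set of edges incident on $v$. For a function $u$ on the network, $u_e=u|_e$, and $u_e(v)$ is its value at the endpoint $v$. $L^2(\mathcal E)$ and $H^1(\mathcal E)$ are the spaces of functions with $u_e\in L^2(e)$, resp. $H^1(e)$, for every $e$ (no continuity at vertices); $(u,v)_{\mathcal E}=\sum_{e}\int_0^{\ell_e}u_ev_e\,dx$, $\int_{\mathcal E}u\,dx=\sum_e\int_0^{\ell_e}u_e\,dx$;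 $(\partial_x'u)|_e=\partial_x(u_e)$. $H_0(\mathrm{div})=\{m\in H^1(\mathcal E):\sum_{e\in\mathcal E(v)}m_e(v)n_e(v)=0\ \forall v\in\mathcal V\}$. Data. $a_e,b_e\ge0$, $c_e>0$ are constants on each edge, $a,b$ the edgewise constant functions with values $a_e,b_e$; $\gamma>1$; $P_e(\rho)=\frac{c_e}{\gamma-1}\rho^\gamma$; $P(\rho),P'(\rho)$ have restrictions $P_e(\rho_e),P_e'(\rho_e)$ to $e$. Finite element spaces. $T_h(e)$ is a uniform mesh of $[0,\ell_e]$ into finitely many subintervals $K$, and $T_h(\mathcal E)$ is the collection of these meshes. $P_k(T_h(\mathcal E))$ is the space of functions in $L^2(\mathcal E)$ that are polynomials of degree $\le k$ on every element $K$. $V_h=P_1(T_h(\mathcal E))\cap H_0(\mathrm{div})$ and $Q_h=P_0(T_h(\mathcal E))$. Semi-discrete problem (S): given $\rho_{0,h}\in Q_h$ with $\rho_{0,h}>0$ and $m_{0,h}\in V_h$, find $(\rho_h,m_h)\in C^1([0,T];Q_h\times V_h)$ with $\rho_h>0$, $\rho_h(0)=\rho_{0,h}$, $m_h(0)=m_{0,h}$, such that for all $q_h\in Q_h$, $v_h\in V_h$ and every $t\in[0,T]$ \begin{align*} (\partial_t\rho_h,q_h)_{\mathcal E}&=-(\partial_x'm_h,q_h)_{\mathcal E},\\ \Big(\tfrac1{\rho_h}\partial_tm_h-\tfrac{m_h}{2\rho_h^2}\partial_t\rho_h,v_h\Big)_{\mathcal E}&=\Big(\tfrac{m_h^2}{2\rho_h^2}+P'(\rho_h)-\tfrac{a}{\rho_h^2}\partial_x'm_h,\partial_x'v_h\Big)_{\mathcal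 E}-\Big(\tfrac{m_h}{2\rho_h^2}\partial_x'm_h+b\tfrac{|m_h|m_h}{\rho_h^2},v_h\Big)_{\mathcal E}. \end{align*} *)

(* Defs.v *)
From HB Require Import structures.
From mathcomp Require Import all_boot all_order all_algebra.
From mathcomp Require Import all_classical all_reals all_analysis.
Import Order.TTheory GRing.Theory Num.Theory.
Import numFieldNormedType.Exports.

Set Implicit Arguments.
Unset Strict Implicit.
Unset Printing Implicit Defensive.

Local Open Scope classical_set_scope.
Local Open Scope ring_scope.

(* Self-loops are excluded: for an edge (v, v) the sign n_e(v) and the endpoint
   value u_e(v) would not be well defined. Connectedness ignores the orientation
   of the edges. *)
Record network (R : realType) := Network {
  vertex :> finType;
  edges : {set vertex * vertex};
  len : vertex * vertex -> R;
  len_gt0 : forall e, e \in edges -> 0 < len e;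
  no_loop : forall v, (v, v) \notin edges;
  net_connected : forall v w,
    connect [rel x y | ((x, y) \in edges) || ((y, x) \in edges)] v w }.

Section Network.
Context {R : realType} (G : network R).

Local Notation mu := (@lebesgue_measure R).

(* [u e x] is meaningful only for [e \in edges G] and [0 <= x <= len e]. Elements
   of L^2 are represented by functions, compared almost everywhere; elements of
   H^1 by their continuous representative on each edge, so that the values at the
   vertices make sense. *)
Definition edge_fun := G * G -> R -> R.

Definition incident (e : G * G) (v : G) : bool := (v == e.1) || (v == e.2).

Definition normal (e : G * G) (v : G) : R :=
  if v == e.1 then -1 else if v == e.2 then 1 else 0.

Definition vertex_value (u : edge_fun) (e : G * G) (v : G) : R :=
  if v == e.1 then u e 0 else u e (len e).

Definition int_net (u : edge_fun) : R :=
  \sum_(e in edges G) \int[mu]_(x in `[0, len e]) u e x.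

Definition inner (u v : edge_fun) : R := int_net (fun e x => u e x * v e x).

Definition norm_net (u : edge_fun) : R := Num.sqrt (inner u u).

(* Classical derivative on each edge: functions of H^1(0, l) are absolutely
   continuous, and their a.e. derivative is the weak one. Its values where the
   derivative does not exist (a null set) are irrelevant. *)
Definition dx (u : edge_fun) : edge_fun := fun e => derive1 (u e).

Definition ae_eq_net (u v : edge_fun) : Prop :=
  forall e, e \in edges G -> {ae mu, forall x, x \in `[0, len e] -> u e x = v e x}.

Definition positive (u : edge_fun) : Prop :=
  forall e, e \in edges G -> {ae mu, forall x, x \in `[0, len e] -> 0 < u e x}.

Definition L2_interval (l : R) (f : R -> R) : Prop :=
  f \_ `[0, l] \in Lfun mu 2%:E.

Definition test_function (l : R) (phi : R -> R) : Prop :=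
  (forall n x, derivable (derive1n n phi) x 1) /\
  (exists a b, [/\ 0 < a, a <= b, b < l &
     forall x, x \notin `[a, b] -> phi x = 0]).

Definition weak_derivative (l : R) (f g : R -> R) : Prop :=
  forall phi, test_function l phi ->
    \int[mu]_(x in `[0, l]) (f x * derive1 phi x) =
    - \int[mu]_(x in `[0, l]) (g x * phi x).

Definition H1_interval (l : R) (f : R -> R) : Prop :=
  [/\ {within `[0, l], continuous f}, L2_interval l f &
      exists2 g, L2_interval l g & weak_derivative l f g].

Definition L2_net : set edge_fun :=
  [set u | forall e, e \in edges G -> L2_interval (len e) (u e)].

Definition H1_net : set edge_fun :=
  [set u | forall e, e \in edges G -> H1_interval (len e) (u e)].

Definition H0div : set edge_fun :=
  [set m | H1_net m /\ forall v : G,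
     \sum_(e in edges G | incident e v) vertex_value m e v * normal e v = 0].

(* [N e] is the number of elements of the uniform mesh of the edge [e]; the
   polynomial is prescribed only in the interior of an element, since the values
   at mesh points do not matter in L^2. *)
Definition Pk (N : G * G -> nat) (k : nat) : set edge_fun :=
  [set u | L2_net u /\
     forall e, e \in edges G -> forall i : 'I_(N e),
       exists2 p : {poly R}, (size p <= k.+1)%N &
         forall x, x \in `](i%:R * len e / (N e)%:R), (i.+1%:R * len e / (N e)%:R)[ ->
           u e x = p.[x]].

Definition Vh N : set edge_fun := Pk N 1 `&` H0div.

Definition Qh N : set edge_fun := Pk N 0.

(* [u] is of class C^1 on [0, T] with values in the space [X], normed by L^2,
   and [du] is its time derivative (one-sided at 0 and T). *)
Definition C1_curve (X : set edge_fun) (T : R) (u du : R -> edge_fun) : Prop :=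
  forall t, t \in `[0, T] ->
  [/\ X (u t), X (du t),
      norm_net (fun e x => (u s e x - u t e x) / (s - t) - du t e x)
        @[s --> within `[0, T] t^'] --> 0 &
      norm_net (fun e x => du s e x - du t e x)
        @[s --> within `[0, T] (nbhs t)] --> 0].

Definition potential (c : G * G -> R) (gamma : R) (e : G * G) (r : R) : R :=
  c e / (gamma - 1) * r `^ gamma.

Definition P_net c gamma (rho : edge_fun) : edge_fun :=
  fun e x => potential c gamma e (rho e x).

Definition dP_net c gamma (rho : edge_fun) : edge_fun :=
  fun e x => derive1 (potential c gamma e) (rho e x).

Definition mass_equation N (drho m : edge_fun) : Prop :=
  forall q, Qh N q -> inner drho q = - inner (dx m) q.

Definition momentum_equation N (a b c : G * G -> R) (gamma : R)
    (rho m drho dm : edge_fun) : Prop :=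
  forall v, Vh N v ->
    inner (fun e x => 1 / rho e x * dm e x
                      - m e x / (2 * rho e x ^+ 2) * drho e x) v =
    inner (fun e x => m e x ^+ 2 / (2 * rho e x ^+ 2) + dP_net c gamma rho e x
                      - a e / rho e x ^+ 2 * dx m e x) (dx v)
    - inner (fun e x => m e x / (2 * rho e x ^+ 2) * dx m e x
                        + b e * (`|m e x| * m e x / rho e x ^+ 2)) v.

Definition semidiscrete_solution N (a b c : G * G -> R) (gamma T : R)
    (rho0 m0 : edge_fun) (rho m : R -> edge_fun) : Prop :=
  exists drho dm : R -> edge_fun,
  [/\ C1_curve (Qh N) T rho drho /\ C1_curve (Vh N) T m dm,
      forall t, t \in `[0, T] -> positive (rho t),
      ae_eq_net (rho 0) rho0 /\ ae_eq_net (m 0) m0,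
      forall t, t \in `[0, T] -> mass_equation N (drho t) (m t) &
      forall t, t \in `[0, T] ->
        momentum_equation N a b c gamma (rho t) (m t) (drho t) (dm t)].

Definition energy c gamma (rho m : edge_fun) : R :=
  int_net (fun e x => m e x ^+ 2 / (2 * rho e x) + P_net c gamma rho e x).

Definition dissipation (a b : G * G -> R) (rho m : edge_fun) : R :=
  int_net (fun e x => a e * (`|dx m e x| ^+ 2 / `|rho e x| ^+ 2)
                      + b e * (`|m e x| ^+ 3 / `|rho e x| ^+ 2)).

End Network.

(* Main.v *)
(** On an element K of length h, rho is a constant r and m is A + B (x - mid K),
    so that the L^2 convergences in the C^1 condition are convergences of the
    coefficients r, A, B, and

      int_K (m^2/(2 rho) + P(rho)) = (h A^2 + h^3/12 B^2)/(2 r) + h P(r)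

    is a differentiable function of time. Its derivative is the integral over K of
    (dm/rho - m drho/(2 rho^2)) m + P'(rho) drho. Summed over the elements, the
    first term is given by the momentum equation tested with v = m, and the second
    one by the mass equation tested with q = P'(rho), which is piecewise constant;
    the terms (P'(rho), dx m) and (m^2/(2 rho^2), dx m) cancel, and minus the
    dissipation remains. The energy identity is then the fundamental theorem of
    calculus in time: the continuity of the dissipation comes from that of the
    derivative of the energy. For the mass, test with q = 1: the integral of dx m
    is the sum over the edges of the boundary fluxes, which vanishes by
    rearranging it over the vertices. *)

Require Import Defs.
From HB Require Import structures.
From mathcomp Require Import all_boot all_order all_algebra.
From mathcomp Require Import all_classical all_reals all_analysis.
From mathcomp Require Import measurable_realfun ring lra.
Import Order.TTheory GRing.Theory Num.Theory.
Import numFieldNormedType.Exports.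
Set Implicit Arguments.
Unset Strict Implicit.
Unset Printing Implicit Defensive.

Local Open Scope classical_set_scope.
Local Open Scope ring_scope.

(** * Integration of piecewise continuous functions and of quadratics *)

Lemma integrable_setU d (T : measurableType d) (R : realType)
    (mu : {measure set T -> \bar R}) (A B : set T) (f : T -> R) :
  measurable A -> measurable B ->
  [disjoint A & B] -> mu.-integrable A (EFin \o f) -> mu.-integrable B (EFin \o f) ->
  mu.-integrable (A `|` B) (EFin \o f).
Proof.
move=> mA mB AB /integrableP[mfA iA] /integrableP[mfB iB].
have mfAB : measurable_fun (A `|` B) (EFin \o f) by rewrite measurable_funU.
apply/integrableP; split => //.
rewrite ge0_integral_setU//; last exact: measurableT_comp.
exact: lte_add_pinfty.
Qed.

Section PiecewiseIntegral.
Context {R : realType}.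
Local Notation mu := (@lebesgue_measure R).
Implicit Types (f g : R -> R) (a b : R).

Lemma continuous_integrable_itv g a b : continuous g ->
  mu.-integrable `[a, b] (EFin \o g).
Proof.
move=> cg; apply: continuous_compact_integrable; first exact: segment_compact.
exact: continuous_subspaceT.
Qed.

Section OnePiece.
Variables (f g : R -> R) (a b : R).
Hypothesis fg : forall x, x \in `]a, b[ -> f x = g x.
Hypothesis cg : continuous g.

(** Nothing is known of [f] at [a] and [b], just as [Pk] prescribes nothing at mesh points; the two
    endpoints are measurable singletons of measure zero, so the open interval decides. *)
Lemma measurable_fun_piece : measurable_fun (`[a, b] : set (measurableTypeR R)) f.
Proof.
apply/measurable_fun_itv_obnd_cbndP/measurable_fun_itv_bndo_bndcP.
apply: (eq_measurable_fun g) => [x /set_mem /= xab|]; first by rewrite fg.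
by apply: measurable_funTS; exact: continuous_measurable_fun.
Qed.

Lemma integrable_piece : mu.-integrable `[a, b] (EFin \o f).
Proof.
have mf := measurable_fun_piece.
have mg : measurable_fun (`[a, b] : set (measurableTypeR R)) g.
  by apply: measurable_funTS; exact: continuous_measurable_fun.
have /integrableP[_] := continuous_integrable_itv a b cg.
move=> ig; apply/integrableP; split; first exact/measurable_EFinP.
rewrite (_ : (\int[mu]_(x in `[a, b]) _ =
    \int[mu]_(x in `[a, b]) `|(EFin \o g) x|)%E)//.
have open_eq (k : R -> R) : measurable_fun (`[a, b] : set (measurableTypeR R)) k ->
  (\int[mu]_(x in `[a, b]) `|(EFin \o k) x| =
   \int[mu]_(x in `]a, b[) `|(EFin \o k) x|)%E.
  move=> mk; have mk' : measurable_fun (`[a, b] : set (measurableTypeR R))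
      (fun x => `|(EFin \o k) x|%E).
    by apply: measurableT_comp => //; exact/measurable_EFinP.
  rewrite -integral_itv_bndo_bndc -?integral_itv_obnd_cbnd//.
    by apply: measurable_funS mk' => //; move=> z; rewrite /= !in_itv /= => /andP[/ltW-> /ltW].
  by apply: measurable_funS mk' => //; move=> z; rewrite /= !in_itv /= => /andP[-> /ltW].
rewrite !open_eq//.
by apply: eq_integral => x /set_mem /= xab; rewrite fg.
Qed.

Lemma Rintegral_piece : \int[mu]_(x in `[a, b]) f x = \int[mu]_(x in `[a, b]) g x.
Proof.
have io (k : R -> R) : mu.-integrable `[a, b] (EFin \o k) ->
   \int[mu]_(x in `[a, b]) k x = \int[mu]_(x in `]a, b[) k x.
  by move=> ik; rewrite -Rintegral_itv_obnd_cbnd ?Rintegral_itv_bndo_bndc//;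
    apply: integrableS ik => // z; rewrite /= !in_itv /= => /andP[/ltW-> // /ltW->].
rewrite !io; last exact: integrable_piece; last exact: continuous_integrable_itv.
by apply: eq_Rintegral => x /set_mem /= xab; rewrite fg.
Qed.

End OnePiece.

(** Induction on the number of pieces. The closed pieces share nodes, so the new one is first
    attached as the half-open []x n, x n.+1]], which is disjoint from the rest, and then closed at
    no cost for the integral. *)
Lemma integral_pieces f (g : nat -> R -> R) (x : nat -> R) n :
  {homo x : i j / (i <= j)%N >-> i <= j} ->
  (forall i, (i < n)%N -> continuous (g i) /\
     forall y, y \in `]x i, x i.+1[ -> f y = g i y) ->
  mu.-integrable `[x 0%N, x n] (EFin \o f) /\
  \int[mu]_(y in `[x 0%N, x n]) f y =
    \sum_(i < n) \int[mu]_(y in `[x i, x i.+1]) g i y.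
Proof.
move=> xle; elim: n => [_|n IH fg].
  rewrite set_itv1 big_ord0 Rintegral_set1; split => //.
  (* The interval is a single point: its interior is empty, so any continuous function serves as its
     piece. *)
  rewrite -set_itv1; apply: (@integrable_piece _ (cst 0)).
    by move=> y; rewrite in_itv /= => /andP[/lt_trans/[apply]]; rewrite ltxx.
  exact: cst_continuous.
have [i IHn] := IH (fun i ii => fg i (ltnW ii)).
have [cg fgn] := fg n (ltnSn n).
have ip := integrable_piece fgn cg.
have -> : [set` `[x 0%N, x n.+1]] = `[x 0%N, x n] `|` `]x n, x n.+1].
  by rewrite -itv_bndbnd_setU// bnd_simp xle.
have dis : [disjoint `[x 0%N, x n]%classic & `]x n, x n.+1]%classic].
  apply/disj_setPS => y [/=]; rewrite 2!in_itv/= => /andP[_ yx] /andP[].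
  by rewrite ltNge yx.
have ip' : mu.-integrable `]x n, x n.+1] (EFin \o f).
  by apply: integrableS ip => //; move=> z; rewrite /= !in_itv /= => /andP[/ltW->].
have iU : mu.-integrable (`[x 0%N, x n] `|` `]x n, x n.+1]) (EFin \o f).
  by apply: integrable_setU => //; exact: measurable_itv.
split; first exact: iU.
rewrite Rintegral_setU//.
rewrite IHn big_ord_recr/=; congr (_ + _).
by rewrite Rintegral_itv_obnd_cbnd// (@Rintegral_piece _ (g n)).
Qed.

End PiecewiseIntegral.


(** Around the midpoint the first moment vanishes, which removes [p1], and the second moment is
    [h ^+ 3 / 12]. The closed forms of all integrals over elements come from here. *)
Lemma Rintegral_quadratic (R : realType) (a h p0 p1 p2 : R) : 0 < h ->
  \int[@lebesgue_measure R]_(x in `[a, a + h])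
    (p0 + p1 * (x - (a + h / 2)) + p2 * (x - (a + h / 2)) ^+ 2) =
  h * p0 + h ^+ 3 / 12 * p2.
Proof.
move=> h0; pose c := a + h / 2.
pose f (x : R) := p0 + p1 * (x - c) + p2 * (x - c) ^+ 2.
pose F (x : R) := p0 * (x - c) + p1 / 2 * (x - c) ^+ 2 + p2 / 3 * (x - c) ^+ 3.
have dF (x : R) : is_derive x 1 F (f x).
  rewrite /F; apply: is_derive_eq.
  by rewrite /f /GRing.scale/=; field.
have dcont (x : R) : {for x, continuous F}.
  by apply/differentiable_continuous/derivable1_diffP; have [] := dF x.
have cf : continuous f.
  move=> x; rewrite /f; apply: cvgD; first apply: cvgD.
  - exact: cvg_cst.
  - by apply: cvgM; [exact: cvg_cst|apply: cvgB; [exact: cvg_id|exact: cvg_cst]].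
  - apply: cvgM; first exact: cvg_cst.
    by apply: cvgM; (apply: cvgB; [exact: cvg_id|exact: cvg_cst]).
rewrite /Rintegral (@continuous_FTC2 _ f F).
- by rewrite -EFinB/= /F /c; field.
- by rewrite ltrDl.
- exact: continuous_subspaceT.
- split=> [x _||]; first by have [] := dF x.
  + exact/cvg_at_right_filter/dcont.
  + exact/cvg_at_left_filter/dcont.
- by move=> x _; rewrite derive1E; have [_ ->] := dF x.
Qed.

(** * Mesh elements and the coefficients of piecewise polynomials *)

Section Elements.
Context {R : realType} (G : network R) (N : G * G -> nat).
Hypothesis N_gt0 : forall e, e \in edges G -> (0 < N e)%N.
Local Notation mu := (@lebesgue_measure R).
Implicit Types (u v : edge_fun G) (e : G * G) (g : G * G -> nat -> R -> R).

Definition node e (i : nat) : R := i%:R * len e / (N e)%:R.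
Definition meshsize e : R := len e / (N e)%:R.
Definition midpoint e (i : nat) : R := node e i + meshsize e / 2.

(* A difference quotient, rather than a derivative, makes this linear in [u]. *)
Definition slope u e i : R :=
  (u e (midpoint e i + meshsize e / 4) - u e (midpoint e i - meshsize e / 4))
    / (meshsize e / 2).

(** Centring at the midpoint makes the constant and the linear part orthogonal in L^2 of the
    element. *)
Definition affine_piece u e i (x : R) : R :=
  u e (midpoint e i) + slope u e i * (x - midpoint e i).

Definition piecewise u g := forall e, e \in edges G -> forall i, (i < N e)%N ->
  forall x, x \in `]node e i, node e i.+1[ -> u e x = g e i x.

Lemma meshsize_gt0 e : e \in edges G -> 0 < meshsize e.
Proof. by move=> eE; rewrite divr_gt0 ?len_gt0// ltr0n N_gt0. Qed.

Lemma nodeS e i : node e i.+1 = node e i + meshsize e.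
Proof. by rewrite /node /meshsize -natr1 !mulrDl mul1r. Qed.

Lemma node0 e : node e 0 = 0.
Proof. by rewrite /node !mul0r. Qed.

Lemma nodeN e : e \in edges G -> node e (N e) = len e.
Proof.
move=> eE; have : (N e)%:R != 0 :> R by rewrite pnatr_eq0 -lt0n N_gt0.
by move=> N0; rewrite /node mulrAC divff// mul1r.
Qed.

Lemma homo_node e : e \in edges G -> {homo (node e) : i j / (i <= j)%N >-> i <= j}.
Proof.
move=> eE; apply: homo_leq => [x//|y x z|i]; first exact: le_trans.
by rewrite nodeS lerDl ltW// meshsize_gt0.
Qed.

Lemma midpoint_in e i : e \in edges G -> midpoint e i \in `]node e i, node e i.+1[.
Proof.
by move=> eE; rewrite in_itv/= nodeS /midpoint; have := meshsize_gt0 eE; lra.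
Qed.

Lemma quarter_points e i : e \in edges G ->
  (midpoint e i + meshsize e / 4 \in `]node e i, node e i.+1[) /\
  (midpoint e i - meshsize e / 4 \in `]node e i, node e i.+1[).
Proof.
by move=> eE; rewrite !in_itv/= nodeS /midpoint; have := meshsize_gt0 eE; lra.
Qed.

Lemma integral_piecewise u g e : e \in edges G ->
  (forall e i, continuous (g e i)) -> piecewise u g ->
  mu.-integrable `[0, len e] (EFin \o u e) /\
  \int[mu]_(x in `[0, len e]) u e x =
    \sum_(i < N e) \int[mu]_(x in `[node e i, node e i.+1]) g e i x.
Proof.
move=> eE cg ug; have := @integral_pieces _ (u e) (g e) _ (N e) (homo_node eE).
rewrite node0 nodeN//; apply=> i iN.
by split; [exact: cg|exact: ug].
Qed.

Lemma int_net_piecewise u g :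
  (forall e i, continuous (g e i)) -> piecewise u g ->
  int_net u = \sum_(e in edges G) \sum_(i < N e)
    \int[mu]_(x in `[node e i, node e i.+1]) g e i x.
Proof.
by move=> cg ug; apply: eq_bigr => e eE; have [] := integral_piecewise eE cg ug.
Qed.

(** The squares of the pieces are pieces of the square of [u], which is therefore integrable. This
    admits the test functions 1 and [P'(rho)] into [Qh]. *)
Lemma L2_net_piecewise u g :
  (forall e i, continuous (g e i)) -> piecewise u g -> L2_net u.
Proof.
move=> cg ug e eE; have [iu _] := integral_piecewise eE cg ug.
have [isq _] := @integral_piecewise (fun e x => u e x ^+ 2)
  (fun e i x => g e i x ^+ 2) e eE
  (fun e i x => continuousM (cg e i x) (cg e i x))
  (fun e eE i iN x xK => congr1 (fun z => z ^+ 2) (ug e eE i iN x xK)).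
have mu' : measurable_fun (`[0, len e] : set (measurableTypeR R)) (u e).
  by have /measurable_int/measurable_EFinP := iu.
rewrite /L2_interval inE; apply/andP; split.
  by rewrite inE/=; apply/(measurable_restrictT _ _).1.
rewrite inE /= /finite_norm unlock /=.
apply: poweR_lty.
have /integrableP[_] := isq.
(* The norm integrates the restriction of [u e] over the whole line; outside the edge its square is
   0. *)
rewrite [in X in (X < _)%E -> _]integral_mkcond.
apply: le_lt_trans; rewrite le_eqVlt; apply/orP; left; apply/eqP.
apply: eq_integral => x _ /=; rewrite /patch; case: ifPn => _ /=.
  by rewrite powR_mulrn// normrX.
by rewrite normr0 powR0.
Qed.

Lemma piecewise_const u : Pk N 0 u ->
  piecewise u (fun e i _ => u e (midpoint e i)).
Proof.
move=> [_ Pu] e eE i iN x xK; have [p /size1_polyC -> up] := Pu e eE (Ordinal iN).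
by rewrite !up ?hornerC//; exact: midpoint_in.
Qed.

(** The midpoint and the quarter points lie in the open element, where [u] is a polynomial of degree
    at most 1, and the difference quotient in [slope] is exact for such a polynomial. *)
Lemma piecewise_affine u : Pk N 1 u -> piecewise u (affine_piece u).
Proof.
move=> [_ Pu] e eE i iN x xK; have [p sp up] := Pu e eE (Ordinal iN).
have {}up y : y \in `]node e i, node e i.+1[ -> u e y = p`_0 + p`_1 * y.
  move=> yK; rewrite up// -(coefK p) (@horner_coef_wide _ 2) ?coefK//.
  by rewrite !big_ord_recl big_ord0/= expr0 mulr1 addr0 expr1.
have [q1 q2] := quarter_points i eE; have hne := lt0r_neq0 (meshsize_gt0 eE).
by rewrite /affine_piece /slope !up ?midpoint_in//; field.
Qed.

Lemma dx_affine u : piecewise u (affine_piece u) ->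
  piecewise (dx u) (fun e i _ => slope u e i).
Proof.
move=> pu e eE i iN x xK; rewrite /dx derive1E.
(* The derivative at [x] is local, and the open element is a neighbourhood of [x]. *)
rewrite (near_eq_derive (g := affine_piece u e i)); last first.
  near=> y; apply: pu => //; near: y; exact: near_in_itvoo.
suff [_ ->] : is_derive x 1 (affine_piece u e i) (slope u e i) by [].
by rewrite /affine_piece; apply: is_derive_eq; rewrite /GRing.scale/=; ring.
Unshelve. all: by end_near. Qed.

Lemma continuous_affine_piece u e i : continuous (affine_piece u e i).
Proof.
move=> x; apply: cvgD; first exact: cvg_cst.
by apply: cvgM; [exact: cvg_cst|apply: cvgB; [exact: cvg_id|exact: cvg_cst]].
Qed.

Lemma Pk_le u k : Pk N 0 u -> Pk N k u.
Proof.
move=> [L2u Pu]; split=> // e eE i; have [p sp up] := Pu e eE i.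
by exists p => //; exact: leq_trans sp _.
Qed.

End Elements.


(** * Scalar functions of class C^1 on a closed time interval *)

Section C1Function.
Context {R : realType}.
Implicit Types (f df : R -> R) (T t : R).

(** The scalar counterpart of [C1_curve]: both limits are written as differences tending to 0, the
    form that a bound by [norm_net] delivers. *)
Definition C1_function T f df := forall t, t \in `[0, T] ->
  ((f s - f t) / (s - t) - df t @[s --> within `[0, T] t^'] --> 0) /\
  (df s - df t @[s --> within `[0, T] (nbhs t)] --> 0).

Lemma C1_function_is_derive T f df : C1_function T f df ->
  forall t, t \in `]0, T[ -> is_derive t 1 f (df t).
Proof.
move=> C1 t t0T; have t0T' : t \in `[0, T].
  by move: t0T; rewrite !in_itv/= => /andP[/ltW-> /ltW->].
have [q0 _] := C1 t t0T'.
have {}q0 : h^-1 *: (f (h *: 1 + t) - f t) @[h --> 0^'] --> df t.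
  apply/cvgrPdist_lt => eps eps0.
  have q : \forall s \near within `[0, T] t^',
      `|(f s - f t) / (s - t) - df t| < eps by exact: cvgr0_norm_lt.
  move: q; rewrite 2!near_withinE => /nbhs0P q.
  (* As [t] is interior, [t + h] stays in [[0, T]] for small [h], and the limit within [[0, T]]
     becomes the two-sided one. *)
  have /nbhs0P tI := near_in_itvoo t0T.
  rewrite near_withinE; near=> h => h0; rewrite distrC.
  have -> : h^-1 *: (f (h *: 1 + t) - f t) = (f (t + h) - f t) / (t + h - t).
    by rewrite /GRing.scale/= mulr1 addrAC subrr add0r mulrC [h + t]addrC.
  apply: (near q h) => //; first by rewrite -subr_eq0 addrAC subrr add0r.
  have : t + h \in `]0, T[ by near: h.
  by rewrite /= !in_itv/= => /andP[/ltW-> /ltW->].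
apply: DeriveDef; first by apply/cvg_ex; exists (df t).
exact/cvg_lim.
Unshelve. all: by end_near. Qed.

(** Multiply the difference quotient, which converges, by [s - t], which tends to 0. This controls
    [s != t]; the case [s = t] is trivial. *)
Lemma C1_function_cvg T f df : C1_function T f df ->
  forall t, t \in `[0, T] -> f s @[s --> within `[0, T] (nbhs t)] --> f t.
Proof.
move=> C1 t t0T; have [q0 _] := C1 t t0T.
have q1 : (f s - f t) / (s - t) @[s --> within `[0, T] t^'] --> df t.
  exact/subr_cvg0.
have q2 : s - t @[s --> within `[0, T] t^'] --> t - t.
  apply: cvgB; last exact: cvg_cst.
  by apply: cvg_within_filter; apply: cvg_within_filter => A.
have q3 : (f s - f t) / (s - t) * (s - t)
    @[s --> within `[0, T] t^'] --> 0.
  have := cvgM q1 q2; rewrite subrr mulr0; apply.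
apply/cvgrPdist_lt => eps eps0; have q : \forall s \near within `[0, T] t^',
  `|(f s - f t) / (s - t) * (s - t)| < eps by exact: cvgr0_norm_lt.
move: q; rewrite !near_withinE => q; near=> s => sT.
have [->|st] := eqVneq s t; first by rewrite subrr normr0.
have : s != t -> `[0, T]%classic s ->
  `|(f s - f t) / (s - t) * (s - t)| < eps by near: s.
by move=> /(_ st sT); rewrite divfK ?subr_eq0// distrC.
Unshelve. all: by end_near. Qed.

Lemma C1_function_cvg_deriv T f df : C1_function T f df ->
  forall t, t \in `[0, T] -> df s @[s --> within `[0, T] (nbhs t)] --> df t.
Proof. by move=> C1 t /C1[_ ?]; apply/subr_cvg0. Qed.

End C1Function.

(** * From L^2 convergence to convergence of the coefficients *)

Section Coefficients.
Context {R : realType} (G : network R) (N : G * G -> nat).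
Hypothesis N_gt0 : forall e, e \in edges G -> (0 < N e)%N.
Local Notation mu := (@lebesgue_measure R).
Implicit Types (u v : edge_fun G) (e : G * G).

Definition affine u := piecewise N u (affine_piece N u).

Lemma inner_affine u : affine u ->
  inner u u = \sum_(e in edges G) \sum_(i < N e)
    (meshsize N e * u e (midpoint N e i) ^+ 2
     + meshsize N e ^+ 3 / 12 * slope N u e i ^+ 2).
Proof.
move=> au; rewrite /inner (@int_net_piecewise _ _ N N_gt0 _
  (fun e i x => affine_piece N u e i x * affine_piece N u e i x)); first last.
- by move=> e eE i iN x xK; rewrite (au e eE i iN x xK).
- by move=> e i x; apply: cvgM; exact: continuous_affine_piece.
apply: eq_bigr => e eE; apply: eq_bigr => i _.
set A := u e _; set B := slope _ _ _ _.
rewrite nodeS -(Rintegral_quadratic (node N e i) (A ^+ 2) (2 * A * B) (B ^+ 2));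
  last exact: meshsize_gt0.
by apply: eq_Rintegral => x _; rewrite /affine_piece -/A -/B /midpoint; ring.
Qed.

(** By orthogonality [inner u u] is a sum of squares with positive weights, so it dominates each of
    its terms. *)
Lemma coefficients_le u e i : affine u -> e \in edges G -> (i < N e)%N ->
  meshsize N e * u e (midpoint N e i) ^+ 2 <= inner u u /\
  meshsize N e ^+ 3 / 12 * slope N u e i ^+ 2 <= inner u u.
Proof.
move=> au eE iN; rewrite inner_affine//.
have pos1 e' (i' : nat) : e' \in edges G ->
    0 <= meshsize N e' * u e' (midpoint N e' i') ^+ 2.
  by move=> eE'; rewrite mulr_ge0 ?sqr_ge0// ltW// meshsize_gt0.
have pos2 e' (i' : nat) : e' \in edges G ->
    0 <= meshsize N e' ^+ 3 / 12 * slope N u e' i' ^+ 2.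
  by move=> eE'; rewrite mulr_ge0 ?sqr_ge0// divr_ge0// exprn_ge0// ltW// meshsize_gt0.
rewrite (bigD1 e)//= (bigD1 (Ordinal iN))//=.
set S1 := \sum_(i < _ | _) _; set S2 := \sum_(e in _ | _) _.
have S1_ge0 : 0 <= S1 by apply: sumr_ge0 => j _; rewrite addr_ge0 ?pos1 ?pos2.
have S2_ge0 : 0 <= S2.
  apply: sumr_ge0 => e' /andP[eE' _]; apply: sumr_ge0 => j _.
  by rewrite addr_ge0 ?pos1 ?pos2.
by have := pos1 e i eE; have := pos2 e i eE; lra.
Qed.

Lemma norm_net_sqr u : affine u -> norm_net u ^+ 2 = inner u u.
Proof.
move=> au; rewrite sqr_sqrtr// inner_affine//; apply: sumr_ge0 => e eE.
have h0 := ltW (meshsize_gt0 N_gt0 eE).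
by apply: sumr_ge0 => i _; rewrite addr_ge0// mulr_ge0 ?sqr_ge0// divr_ge0// exprn_ge0.
Qed.

Lemma cvg0_of_sqr_le (T : Type) (F : set_system T) {FF : Filter F} (f n : T -> R) (K : R) :
  0 < K -> (\forall s \near F, K * f s ^+ 2 <= n s ^+ 2) ->
  n s @[s --> F] --> 0 -> f s @[s --> F] --> 0.
Proof.
move=> K0 Kf n0; apply/cvgr0Pnorm_lt => eps eps0.
(* With this threshold for [n], the bound [K * f s ^+ 2 <= n s ^+ 2] yields [|f s| < eps]. *)
have sK : 0 < Num.sqrt K * eps by rewrite mulr_gt0// sqrtr_gt0.
have nK : \forall s \near F, `|n s| < Num.sqrt K * eps by exact: cvgr0_norm_lt.
apply: filterS2 Kf nK => s Kf.
rewrite -ltr_sqr ?nnegrE ?(ltW sK)// exprMn sqr_sqrtr ?(ltW K0)//.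
rewrite real_normK ?num_real// => /(le_lt_trans Kf); rewrite ltr_pM2l//.
by rewrite -real_normK ?num_real// ltr_sqr// nnegrE ltW.
Qed.

Lemma affine_lin u v w c : affine u -> affine v -> affine w ->
  affine (fun e x => (u e x - v e x) / c - w e x).
Proof.
move=> au av aw e eE i iN x xK.
rewrite (au e eE i iN x xK) (av e eE i iN x xK) (aw e eE i iN x xK).
rewrite /affine_piece /slope; ring.
Qed.

Lemma affine_sub u v : affine u -> affine v -> affine (fun e x => u e x - v e x).
Proof.
move=> au av e eE i iN x xK; rewrite (au e eE i iN x xK) (av e eE i iN x xK).
rewrite /affine_piece /slope; ring.
Qed.

(** Taking a midpoint value or a slope is linear, so it commutes with the difference quotient in
    time, and on affine functions it is bounded by the L^2 norm. *)
Lemma coefficients_C1 (X : set (edge_fun G)) T (u du : R -> edge_fun G) e i :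
  (forall v, X v -> affine v) -> C1_curve X T u du ->
  e \in edges G -> (i < N e)%N ->
  C1_function T (fun t => u t e (midpoint N e i)) (fun t => du t e (midpoint N e i)) /\
  C1_function T (fun t => slope N (u t) e i) (fun t => slope N (du t) e i).
Proof.
move=> Xa C1 eE iN.
have au t : t \in `[0, T] -> affine (u t) /\ affine (du t).
  by move=> /C1[? ? _ _]; split; exact: Xa.
have h0 := meshsize_gt0 N_gt0 eE.
have h3 : 0 < meshsize N e ^+ 3 / 12 by rewrite divr_gt0// exprn_gt0.
(* Applied to [w] the error of the difference quotient, then to the increment of [du]. *)
have key (F : set_system R) (w : R -> edge_fun G) : Filter F ->
    (\forall s \near F, affine (w s)) -> norm_net (w s) @[s --> F] --> 0 ->
    (w s e (midpoint N e i) @[s --> F] --> 0) /\ (slope N (w s) e i @[s --> F] --> 0).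
  move=> FF aw n0; split.
    apply: (cvg0_of_sqr_le h0 _ n0); apply: filterS aw => s aw.
    by rewrite norm_net_sqr//; have [] := coefficients_le aw eE iN.
  apply: (cvg0_of_sqr_le h3 _ n0); apply: filterS aw => s aw.
  by rewrite norm_net_sqr//; have [] := coefficients_le aw eE iN.
split=> t t0T; have [_ _ nq nd] := C1 t t0T; have [aut adut] := au t t0T.
  split.
    apply: (key _ _ _ _ nq).1; rewrite 2!near_withinE; apply: nearW => s _ /au[aus _].
    exact: affine_lin.
  apply: (key _ _ _ _ nd).1; rewrite near_withinE; apply: nearW => s /au[_ adus].
  exact: affine_sub.
split.
  rewrite (_ : (fun s => _) = fun s =>
    slope N (fun e x => (u s e x - u t e x) / (s - t) - du t e x) e i); last first.
    by apply/funext => s; rewrite /slope; ring.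
  apply: (key _ _ _ _ nq).2; rewrite 2!near_withinE; apply: nearW => s _ /au[aus _].
  exact: affine_lin.
rewrite (_ : (fun s => _) = fun s =>
  slope N (fun e x => du s e x - du t e x) e i); last first.
  by apply/funext => s; rewrite /slope; ring.
apply: (key _ _ _ _ nd).2; rewrite near_withinE; apply: nearW => s /au[_ adus].
exact: affine_sub.
Qed.

End Coefficients.


(** * Values at nodes, fluxes and the mass balance *)

Ltac continuity := move=> ?; repeat first
  [ exact: cvg_cst | exact: cvg_id | exact: continuous_affine_piece
  | apply: cvgN | apply: cvgD | apply: cvgM | apply: cvg_norm].

(** At each endpoint both functions are the one-sided limit of the same values. This recovers [m] at
    the nodes, which [Pk] leaves open but the continuity in [H1_net] fixes. *)
Lemma eq_at_endpoints (R : realType) (f g : R -> R) (a b : R) : a < b ->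
  {within `[a, b], continuous f} -> continuous g ->
  {in `]a, b[, f =1 g} -> f a = g a /\ f b = g b.
Proof.
move=> ab /(continuous_within_itvP _ ab)[_ fa fb] cg fg; split.
- apply: (@cvg_unique _ _ (f @ a^'+)) => //.
  apply: (cvg_trans _ (cvg_at_right_filter (cg a))).
  apply: near_eq_cvg; near=> x; rewrite fg// in_itv/=; apply/andP; split; near: x.
    exact: nbhs_right_gt.
  exact: nbhs_right_lt.
- apply: (@cvg_unique _ _ (f @ b^'-)) => //.
  apply: (cvg_trans _ (cvg_at_left_filter (cg b))).
  apply: near_eq_cvg; near=> x; rewrite fg// in_itv/=; apply/andP; split; near: x.
    exact: nbhs_left_gt.
  exact: nbhs_left_lt.
Unshelve. all: by end_near. Qed.

Section Balance.
Context {R : realType} (G : network R) (N : G * G -> nat).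
Hypothesis N_gt0 : forall e, e \in edges G -> (0 < N e)%N.
Local Notation mu := (@lebesgue_measure R).
Local Notation mid := (midpoint N).
Local Notation h := (meshsize N).
Implicit Types (u v q : edge_fun G) (e : G * G).

Lemma Pk0_affine u : Pk N 0 u -> affine N u.
Proof. by move=> /(@Pk_le _ _ _ _ 1) /(piecewise_affine N_gt0). Qed.

(** Positivity is only known almost everywhere, but a nonpositive constant would violate it on a
    whole element, which has positive measure. *)
Lemma positive_midpoint u e i : Pk N 0 u -> positive u ->
  e \in edges G -> (i < N e)%N -> 0 < u e (mid e i).
Proof.
move=> Pu u0 eE iN; rewrite ltNge; apply/negP => um.
have [A [mA A0 sA]] := u0 e eE.
suff KA : `]node N e i, node N e i.+1[%classic `<=` A.
  have : (mu `]node N e i, node N e i.+1[%classic <= 0)%E.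
    by rewrite -A0; apply: le_measure => //; rewrite inE//; exact: measurable_itv.
  rewrite lebesgue_measure_itv/= lte_fin nodeS ltrDl meshsize_gt0//.
  by rewrite -EFinB lee_fin leNgt addrAC subrr add0r meshsize_gt0.
move=> x xK; apply: sA => /= u_gt0.
have := u_gt0 _; rewrite (piecewise_const N_gt0 Pu eE iN xK) ltNge um => /(_ _)/notF.
apply; move: xK; rewrite /= !in_itv/= => /andP[x1 x2]; apply/andP; split.
  by rewrite (le_trans _ (ltW x1))// -(node0 N e) homo_node.
by rewrite (le_trans (ltW x2))// -(nodeN N_gt0 eE) homo_node.
Qed.

(** Each term is the increment of [m] over an element. The sum telescopes because [m] is continuous
    across the interior nodes. *)
Lemma sum_slopes m e : Vh N m -> e \in edges G ->
  \sum_(i < N e) h e * slope N m e i = m e (len e) - m e 0.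
Proof.
move=> [/(piecewise_affine N_gt0) am [H1m _]] eE; have [cm _ _] := H1m e eE.
rewrite -[in RHS](nodeN N_gt0 eE) -[X in _ - m e X](node0 N e).
rewrite -(telescope_sumr (fun i => m e (node N e i)))//.
rewrite big_mkord; apply: eq_bigr => i _.
have lt_node : node N e i < node N e i.+1 by rewrite nodeS ltrDl meshsize_gt0.
have [|||-> ->] := @eq_at_endpoints _ (m e) (affine_piece N m e i) _ _ lt_node.
- apply: continuous_subspaceW cm => x; rewrite /= !in_itv/= => /andP[x1 x2].
  rewrite (le_trans _ x1) -?(node0 N e) ?homo_node//=.
  by rewrite (le_trans x2)// -(nodeN N_gt0 eE) homo_node.
- exact: continuous_affine_piece.
- exact: am.
by rewrite /affine_piece nodeS; ring.
Qed.

(** Add the vertex conditions and exchange the sums: each edge collects the terms of its two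
    endpoints, which [no_loop] makes distinct, with signs -1 and 1. *)
Lemma sum_flux m : H0div m -> \sum_(e in edges G) (m e (len e) - m e 0) = 0.
Proof.
move=> [_ m0].
transitivity (\sum_(v : G) \sum_(e in edges G | incident e v)
    vertex_value m e v * normal e v); last by rewrite big1.
rewrite (exchange_big_dep (mem (edges G)))/=; last by move=> v e _ /andP[].
apply: eq_bigr => e eE; have e12 : e.1 != e.2.
  by apply: contraTneq eE => e12; case: e e12 => x y /= ->; exact: no_loop.
rewrite (bigD1 e.1)/=; last by rewrite eE /incident eqxx.
rewrite (bigD1 e.2)/=; last by rewrite eE /incident eqxx orbT eq_sym.
rewrite big1 => [|v]; last first.
  by rewrite /incident => /andP[/andP[/andP[_ /orP[]]/eqP->]]; rewrite eqxx.
rewrite /vertex_value /normal eqxx [e.2 == e.1]eq_sym (negbTE e12) eqxx; ring.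
Qed.

Lemma int_net_const u (k : G * G -> nat -> R) :
  piecewise N u (fun e i _ => k e i) ->
  int_net u = \sum_(e in edges G) \sum_(i < N e) h e * k e i.
Proof.
move=> uk; rewrite (int_net_piecewise N_gt0 _ uk); last by move=> e i; continuity.
apply: eq_bigr => e eE; apply: eq_bigr => i _.
have := Rintegral_quadratic (node N e i) (k e i) 0 0 (meshsize_gt0 N_gt0 eE).
rewrite mulr0 addr0 nodeS => <-.
by apply: eq_Rintegral => x _; rewrite !mul0r !addr0.
Qed.

(** The sum is the rate of change of the total mass, expressed in the coefficients of [drho]. *)
Lemma mass_balance drho m : Qh N drho -> Vh N m -> mass_equation N drho m ->
  \sum_(e in edges G) \sum_(i < N e) h e * drho e (mid e i) = 0.
Proof.
move=> Qd Vm /(_ (fun _ _ => 1)).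
have Qone : Qh N (fun _ _ => 1 : R).
  split.
    apply: (@L2_net_piecewise _ _ N N_gt0 _ (fun _ _ _ => 1)) => //.
    by move=> e i; continuity.
  by move=> e eE i; exists 1%:P => [|x _]; rewrite ?size_polyC ?oner_eq0 ?hornerC.
move=> /(_ Qone).
have [/(piecewise_affine N_gt0) am _] := Vm.
rewrite /inner (@int_net_const _ (fun e i => drho e (mid e i))); last first.
  by move=> e eE i iN x xK; rewrite mulr1 (piecewise_const N_gt0 Qd eE iN xK).
rewrite (@int_net_const _ (fun e i => slope N m e i)); last first.
  by move=> e eE i iN x xK; rewrite mulr1 (dx_affine am eE iN xK).
move=> ->; apply/eqP; rewrite oppr_eq0; apply/eqP.
under eq_bigr => e eE do rewrite (sum_slopes Vm eE).
by apply: sum_flux; case: Vm.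
Qed.

End Balance.


(** * The energy balance at a fixed time *)

Section EnergyBalance.
Context {R : realType} (G : network R) (N : G * G -> nat).
Hypothesis N_gt0 : forall e, e \in edges G -> (0 < N e)%N.
Variables (a b c : G * G -> R) (gamma : R).
Local Notation mu := (@lebesgue_measure R).
Local Notation mid := (midpoint N).
Local Notation h := (meshsize N).
Implicit Types (rho m drho dm : edge_fun G) (e : G * G).

Lemma energy_piecewise rho m : Qh N rho -> affine N m ->
  energy c gamma rho m = \sum_(e in edges G) \sum_(i < N e)
    ((h e * m e (mid e i) ^+ 2 + h e ^+ 3 / 12 * slope N m e i ^+ 2)
       / (2 * rho e (mid e i))
     + h e * potential c gamma e (rho e (mid e i))).
Proof.
move=> Qrho am; rewrite /energy (@int_net_piecewise _ _ N N_gt0 _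
  (fun e i x => affine_piece N m e i x ^+ 2 / (2 * rho e (mid e i))
                + potential c gamma e (rho e (mid e i)))); first last.
- move=> e eE i iN x xK; rewrite /P_net (am e eE i iN x xK).
  by rewrite (piecewise_const N_gt0 Qrho eE iN xK).
- by move=> e i; continuity.
apply: eq_bigr => e eE; apply: eq_bigr => i _.
set r := rho e _; set p := potential _ _ _ _; set A := m e _; set B := slope _ _ _ _.
rewrite nodeS; transitivity (h e * (A ^+ 2 / (2 * r) + p)
  + h e ^+ 3 / 12 * (B ^+ 2 / (2 * r))); last by ring.
rewrite -(Rintegral_quadratic (node N e i) _ (2 * A * B / (2 * r))) ?meshsize_gt0//.
by apply: eq_Rintegral => x _; rewrite /affine_piece -/A -/B /midpoint; ring.
Qed.

(** The chain rule applied to the energy of one element, with the rates [dr], [dA], [dB] as free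
    variables. The balance is thus an algebraic statement at one instant, separate from
    differentiation in time. *)
Definition energy_rate e (r A B dr dA dB : R) : R :=
  (h e * A * dA + h e ^+ 3 / 12 * B * dB) / r
  - (h e * A ^+ 2 + h e ^+ 3 / 12 * B ^+ 2) / (2 * r ^+ 2) * dr
  + h e * (derive1 (potential c gamma e) r * dr).

Lemma energy_balance rho m drho dm : Qh N rho -> positive rho ->
  Vh N m -> Qh N drho -> Vh N dm ->
  mass_equation N drho m -> momentum_equation N a b c gamma rho m drho dm ->
  \sum_(e in edges G) \sum_(i < N e)
    energy_rate e (rho e (mid e i)) (m e (mid e i)) (slope N m e i)
      (drho e (mid e i)) (dm e (mid e i)) (slope N dm e i)
  = - dissipation a b rho m.
Proof.
move=> Qr r0 Vm Qdr Vdm mass /(_ _ Vm) momentum.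
have am : affine N m by have [/(piecewise_affine N_gt0)] := Vm.
have adm : affine N dm by have [/(piecewise_affine N_gt0)] := Vdm.
have pm := dx_affine am.
have pr := piecewise_const N_gt0 Qr; have pdr := piecewise_const N_gt0 Qdr.
pose r e i := rho e (mid e i); pose M e i x := affine_piece N m e i x.
pose dM e i x := affine_piece N dm e i x; pose B e i := slope N m e i.
pose dr e i := drho e (mid e i); pose p e i := derive1 (potential c gamma e) (r e i).
(* Pieces of the integrands: [gL] is the left side of the momentum equation tested with [m], [gF]
   and [gS] are the two terms of its right side, and [gD] is the dissipation. *)
pose gL e i x := (1 / r e i * dM e i x - M e i x / (2 * r e i ^+ 2) * dr e i) * M e i x.
pose gF e i x := (M e i x ^+ 2 / (2 * r e i ^+ 2) + p e i - a e / r e i ^+ 2 * B e i) * B e i.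
pose gS e i x := (M e i x / (2 * r e i ^+ 2) * B e i
  + b e * (`|M e i x| * M e i x / r e i ^+ 2)) * M e i x.
pose gD e i x := a e * (`|B e i| ^+ 2 / `|r e i| ^+ 2)
  + b e * (`|M e i x| ^+ 3 / `|r e i| ^+ 2).
have cL e i : continuous (gL e i) by rewrite /gL /M /dM; continuity.
have cF e i : continuous (gF e i) by rewrite /gF /M; continuity.
have cS e i : continuous (gS e i) by rewrite /gS /M; continuity.
have cD e i : continuous (gD e i) by rewrite /gD /M; continuity.
have pdP : piecewise N (dP_net c gamma rho) (fun e i _ => p e i).
  by move=> e eE i iN x xK; rewrite /dP_net (pr e eE i iN x xK).
(* [P'(rho)] is constant on elements, hence admissible in the mass equation. *)
have QdP : Qh N (dP_net c gamma rho).
  split; first by apply: (L2_net_piecewise N_gt0 _ pdP) => e i; continuity.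
  move=> e eE i; exists (p e i)%:P => [|x xK]; first by rewrite size_polyC; case: eqP.
  by rewrite hornerC (pdP e eE i _ x xK).
have := mass _ QdP; have := momentum.
rewrite /inner (@int_net_piecewise _ _ N N_gt0 _ gL) //; last first.
  move=> e eE i iN x xK.
  by rewrite (am e eE i iN x xK) (adm e eE i iN x xK) (pr e eE i iN x xK) (pdr e eE i iN x xK).
rewrite (@int_net_piecewise _ _ N N_gt0 _ gF) //; last first.
  move=> e eE i iN x xK.
  rewrite (am e eE i iN x xK) (pm e eE i iN x xK) (pdP e eE i iN x xK).
  by rewrite (pr e eE i iN x xK).
rewrite (@int_net_piecewise _ _ N N_gt0 _ gS) //; last first.
  move=> e eE i iN x xK.
  by rewrite (am e eE i iN x xK) (pm e eE i iN x xK) (pr e eE i iN x xK).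
rewrite (@int_net_piecewise _ _ N N_gt0 _ (fun e i _ => dr e i * p e i)); first last.
- by move=> e eE i iN x xK; rewrite (pdr e eE i iN x xK) (pdP e eE i iN x xK).
- by move=> e i; continuity.
rewrite (@int_net_piecewise _ _ N N_gt0 _ (fun e i _ => B e i * p e i)); first last.
- by move=> e eE i iN x xK; rewrite (pm e eE i iN x xK) (pdP e eE i iN x xK).
- by move=> e i; continuity.
rewrite /dissipation (@int_net_piecewise _ _ N N_gt0 _ gD) //; last first.
  move=> e eE i iN x xK.
  by rewrite (am e eE i iN x xK) (pm e eE i iN x xK) (pr e eE i iN x xK).
move=> eqL eqM.
(* First identify the energy rate with the left sides of the two tested equations, element by
   element. *)
transitivity (\sum_(e in edges G) \sum_(i < N e)
    \int[mu]_(x in `[node N e i, node N e i.+1]) gL e i x +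
  \sum_(e in edges G) \sum_(i < N e)
    \int[mu]_(x in `[node N e i, node N e i.+1]) (dr e i * p e i)).
  rewrite -big_split/=; apply: eq_bigr => e eE.
  rewrite -big_split/=; apply: eq_bigr => i _.
  have ri0 : r e i != 0 by rewrite gt_eqF// positive_midpoint.
  have cst : continuous (fun _ : R => dr e i * p e i) by continuity.
  rewrite -RintegralD//; [|exact: continuous_integrable_itv..].
  set A := m e _; set dA := dm e _; set dB := slope N dm _ _.
  rewrite nodeS /energy_rate -/(r e i) -/(B e i) -/(dr e i) -/(p e i).
  transitivity (h e * (dA * A / r e i - A ^+ 2 / (2 * r e i ^+ 2) * dr e i + dr e i * p e i)
    + h e ^+ 3 / 12 * (dB * B e i / r e i - B e i ^+ 2 / (2 * r e i ^+ 2) * dr e i)).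
    by field.
  (* The linear coefficient leaves no trace in the integral and is supplied by hand: it is the cross
     term in the expansion of [gL]. *)
  rewrite -(Rintegral_quadratic (node N e i) _ ((A * dB + dA * B e i) / r e i
    - 2 * A * B e i / (2 * r e i ^+ 2) * dr e i)) ?meshsize_gt0//.
  apply: eq_Rintegral => x _; rewrite /gL /M /dM /affine_piece -/A -/dA -/(B e i) -/dB.
  by rewrite /midpoint; field.
(* Now insert the equations. The terms in [P'(rho)] and in [m^2/(2 rho^2)] cancel pointwise, so
   comparing integrands suffices. *)
rewrite eqL eqM -!sumrN -!big_split/=; apply: eq_bigr => e eE.
rewrite -!sumrN -!big_split/=; apply: eq_bigr => i _.
have ii := continuous_integrable_itv.
have cst : continuous (fun _ : R => B e i * p e i) by continuity.
have cFS : continuous (fun x => gF e i x - gS e i x).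
  by move=> x; apply: cvgB; [exact: cF|exact: cS].
rewrite -RintegralB//; [|exact: ii..]; rewrite -RintegralB//; [|exact: ii..].
apply/eqP; rewrite eq_sym eqr_oppLR; apply/eqP.
rewrite -[RHS]mulN1r -RintegralZl//; last first.
  by apply: ii => x; apply: cvgB; [exact: cFS|exact: cst].
apply: eq_Rintegral => x _; rewrite /gD /gF /gS.
have -> : `|M e i x| ^+ 3 = `|M e i x| * M e i x ^+ 2.
  by rewrite exprS real_normK ?num_real.
by rewrite !real_normK ?num_real//; ring.
Qed.

End EnergyBalance.


(** * Primitives in time and the fundamental theorem of calculus *)

Section Primitive.
Context {R : realType}.
Local Notation mu := (@lebesgue_measure R).
Implicit Types (f df g dg : R -> R) (T t : R).

(** Derivatives are taken in the open interval and only continuity is asked up to 0 and [T]; in this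
    form the rules for sums, quotients and powers apply directly. *)
Definition primitive T f df :=
  [/\ forall t, t \in `]0, T[ -> is_derive t 1 f (df t),
      forall t, t \in `[0, T] -> f s @[s --> within `[0, T] (nbhs t)] --> f t &
      forall t, t \in `[0, T] -> df s @[s --> within `[0, T] (nbhs t)] --> df t].

Lemma C1_function_primitive T f df : C1_function T f df -> primitive T f df.
Proof.
move=> C1; split; first exact: C1_function_is_derive.
  exact: (C1_function_cvg C1).
exact: (C1_function_cvg_deriv C1).
Qed.

Lemma primitive_sum T (I : Type) (s : seq I) (P : pred I) (f df : I -> R -> R) :
  (forall i, P i -> primitive T (f i) (df i)) ->
  primitive T (fun t => \sum_(i <- s | P i) f i t) (fun t => \sum_(i <- s | P i) df i t).
Proof.
move=> pf; elim: s => [|i s [IH1 IH2 IH3]].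
  under eq_fun do rewrite big_nil; under [X in primitive _ _ X]eq_fun do rewrite big_nil.
  by split=> t _; [exact: is_derive_cst|exact: cvg_cst|exact: cvg_cst].
case Pi : (P i); under eq_fun do rewrite big_cons Pi;
  under [X in primitive _ _ X]eq_fun do rewrite big_cons Pi; last by [].
have [p1 p2 p3] := pf i Pi; split=> t tT.
- by have := p1 t tT; have := IH1 t tT => d1 d2; exact: is_deriveD.
- by apply: cvgD; [exact: p2|exact: IH2].
- by apply: cvgD; [exact: p3|exact: IH3].
Qed.

Lemma primitiveZ T (k : R) f df : primitive T f df ->
  primitive T (fun t => k * f t) (fun t => k * df t).
Proof.
move=> [f1 f2 f3]; split=> t tT; last 2 first.
- by apply: cvgM; [exact: cvg_cst|exact: f2].
- by apply: cvgM; [exact: cvg_cst|exact: f3].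
have ? := f1 t tT; apply: is_derive_eq; rewrite /GRing.scale/=; ring.
Qed.

Lemma primitive_integral T f df t : primitive T f df -> t \in `[0, T] ->
  \int[mu]_(s in `[0, t]) df s = f t - f 0.
Proof.
move=> [f1 f2 f3]; rewrite in_itv/= => /andP[t0 tT].
(* The fundamental theorem is applied on a nondegenerate interval, so [t = 0] is treated apart. *)
have [<-|tn0] := eqVneq 0 t; first by rewrite set_itv1 Rintegral_set1 subrr.
have {tn0}t0 : 0 < t by rewrite lt_neqAle tn0.
have sub x : x \in `[0, t] -> x \in `[0, T].
  by rewrite !in_itv/= => /andP[-> /le_trans->].
have cont (k : R -> R) :
    (forall s, s \in `[0, T] -> k x @[x --> within `[0, T] (nbhs s)] --> k s) ->
    {within `[0, t], continuous k}.
  move=> ck; apply: (@continuous_subspaceW _ _ _ `[0, T]%classic) => //.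
  exact/subspace_continuousP.
have /(continuous_within_itvP _ t0)[_ fl fr] := cont f f2.
have fin s : s \in `]0, t[ -> is_derive s 1 f (df s).
  move=> st; apply: f1; move: st; rewrite !in_itv/= => /andP[-> /lt_le_trans->//].
rewrite /Rintegral (@continuous_FTC2 _ df f) ?EFinB//.
- exact: cont.
- by split=> // s /fin[].
- by move=> s /fin[_ <-]; rewrite derive1E.
Qed.

End Primitive.

(** * Differentiating the energy of one element in time *)

Section Potential.
Context {R : realType} (G : network R) (c : G * G -> R) (gamma : R).

Lemma is_derive_potential e (r : R) : 0 < r ->
  is_derive r 1 (potential c gamma e)
    (c e / (gamma - 1) * (gamma * r `^ (gamma - 1))).
Proof.
move=> r0; have dp := is_derive1_powR gamma r0.
by rewrite /potential; apply: is_derive_eq; rewrite /GRing.scale/=; ring.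
Qed.

Lemma derive1_potential e (r : R) : 0 < r ->
  derive1 (potential c gamma e) r = c e / (gamma - 1) * (gamma * r `^ (gamma - 1)).
Proof. by move=> /(is_derive_potential e)[_ <-]; rewrite derive1E. Qed.

Lemma cvg_powR (T : Type) (F : set_system T) {FF : Filter F} (f : T -> R) (r p : R) :
  0 < r -> f s @[s --> F] --> r -> f s `^ p @[s --> F] --> r `^ p.
Proof.
move=> r0 fr; have ct : {for r, continuous (fun x : R => x `^ p)}.
  by apply/differentiable_continuous/derivable1_diffP; have [] := is_derive1_powR p r0.
exact: cvg_comp fr ct.
Qed.

(** Since [r] stays positive, the quotient and the real power are smooth along the curve. *)
Lemma piece_energy_primitive N T e (r A B dr dA dB : R -> R) :
  (forall t, t \in `[0, T] -> 0 < r t) ->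
  primitive T r dr -> primitive T A dA -> primitive T B dB ->
  primitive T (fun t => (meshsize N e * A t ^+ 2 + meshsize N e ^+ 3 / 12 * B t ^+ 2)
       / (2 * r t) + meshsize N e * potential c gamma e (r t))
    (fun t => energy_rate N c gamma e (r t) (A t) (B t) (dr t) (dA t) (dB t)).
Proof.
move=> r0 [r1 r2 r3] [A1 A2 A3] [B1 B2 B3]; split=> t tT.
- have tT' : t \in `[0, T] by move: tT; rewrite !in_itv/= => /andP[/ltW-> /ltW->].
  have rt0 := r0 t tT'; have rn0 : r t != 0 by rewrite gt_eqF.
  have ? := r1 t tT; have ? := A1 t tT; have ? := B1 t tT.
  have ? : is_derive t 1 (fun s => potential c gamma e (r s))
      (derive1 (potential c gamma e) (r t) * dr t).
    rewrite derive1_potential//.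
    exact: (is_derive1_comp (is_derive_potential e rt0)).
  have ? : is_derive t 1 (fun s => (2 * r s)^-1) (- (2 * r t) ^- 2 *: (2 * dr t)).
    apply: is_deriveV; first by rewrite mulf_neq0.
  by apply: is_derive_eq; rewrite /energy_rate /GRing.scale/=; field.
- apply: cvgD.
    apply: cvgM; first apply: cvgD.
    + by apply: cvgM; [exact: cvg_cst|apply: cvgM; exact: A2].
    + by apply: cvgM; [exact: cvg_cst|apply: cvgM; exact: B2].
    + apply: cvgV; first by rewrite mulf_neq0// gt_eqF// r0.
      by apply: cvgM; [exact: cvg_cst|exact: r2].
  apply: cvgM; first exact: cvg_cst.
  apply: cvgM; first exact: cvg_cst.
  by apply: cvg_powR; [exact: r0|exact: r2].
- have r2V : (2 * r s ^+ 2)^-1 @[s --> within `[0, T] (nbhs t)] --> (2 * r t ^+ 2)^-1.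
    apply: cvgV; first by rewrite mulf_neq0// expf_neq0// gt_eqF// r0.
    by apply: cvgM; [exact: cvg_cst|apply: cvgM; exact: r2].
  have rV : (r s)^-1 @[s --> within `[0, T] (nbhs t)] --> (r t)^-1.
    by apply: cvgV; [rewrite gt_eqF// r0|exact: r2].
  have dP : derive1 (potential c gamma e) (r s) @[s --> within `[0, T] (nbhs t)]
      --> derive1 (potential c gamma e) (r t).
    rewrite derive1_potential ?r0//.
    (* Along the curve [r s > 0], so [derive1] may be replaced by its explicit formula, which is
       continuous. *)
    apply: (@cvg_trans _ (c e / (gamma - 1) * (gamma * r s `^ (gamma - 1))
       @[s --> within `[0, T] (nbhs t)])).
      apply: near_eq_cvg; rewrite near_withinE; apply: nearW => s sT.
      by rewrite derive1_potential// r0.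
    apply: cvgM; first exact: cvg_cst.
    by apply: cvgM; [exact: cvg_cst|apply: cvg_powR; [exact: r0|exact: r2]].
  apply: cvgD.
    apply: cvgB.
      apply: cvgM => //; apply: cvgD.
        by apply: cvgM; [apply: cvgM; [exact: cvg_cst|exact: A2]|exact: A3].
      by apply: cvgM; [apply: cvgM; [exact: cvg_cst|exact: B2]|exact: B3].
    apply: cvgM; last exact: r3.
    apply: cvgM => //; apply: cvgD.
      by apply: cvgM; [exact: cvg_cst|apply: cvgM; exact: A2].
    by apply: cvgM; [exact: cvg_cst|apply: cvgM; exact: B2].
  apply: cvgM; first exact: cvg_cst.
  by apply: cvgM => //; exact: r3.
Qed.

End Potential.

(** * Initial data that agree almost everywhere *)

Lemma int_net_ae_eq (R : realType) (G : network R) (N : G * G -> nat)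
    (u v : edge_fun G) g g' : (forall e, e \in edges G -> (0 < N e)%N) ->
  (forall e i, continuous (g e i)) -> piecewise N u g ->
  (forall e i, continuous (g' e i)) -> piecewise N v g' ->
  ae_eq_net u v -> int_net u = int_net v.
Proof.
move=> N0 cg ug cg' vg' uv; apply: eq_bigr => e eE.
have [iu _] := integral_piecewise N0 eE cg ug.
have [iv _] := integral_piecewise N0 eE cg' vg'.
rewrite /Rintegral; congr fine; apply: ae_eq_integral => //.
- exact: measurable_int iu.
- exact: measurable_int iv.
have [A [mA A0 sA]] := uv e eE; exists A; split=> // x /= nx; apply: sA => /= uvx.
by apply: nx => xI; rewrite uvx.
Qed.


(** The initial conditions hold almost everywhere; this transfers the energy at time 0 to the given
    data. *)
Lemma energy_ae_eq (R : realType) (G : network R) (N : G * G -> nat)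
    (c : G * G -> R) (gamma : R) (rho rho' m m' : edge_fun G) :
  (forall e, e \in edges G -> (0 < N e)%N) ->
  Qh N rho -> Qh N rho' -> affine N m -> affine N m' ->
  ae_eq_net rho rho' -> ae_eq_net m m' ->
  energy c gamma rho m = energy c gamma rho' m'.
Proof.
move=> N0 Qr Qr' am am' rr mm.
pose g rho m : G * G -> nat -> R -> R := fun e i x =>
  affine_piece N m e i x ^+ 2 / (2 * rho e (midpoint N e i))
  + potential c gamma e (rho e (midpoint N e i)).
have cg r u e i : continuous (g r u e i) by rewrite /g; continuity.
have pg r u : Qh N r -> affine N u ->
    piecewise N (fun e x => u e x ^+ 2 / (2 * r e x) + P_net c gamma r e x) (g r u).
  move=> Q au e eE i iN x xK; rewrite /P_net (au e eE i iN x xK).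
  by rewrite (piecewise_const N0 Q eE iN xK).
apply: (int_net_ae_eq N0 (cg rho m) (pg _ _ Qr am) (cg rho' m') (pg _ _ Qr' am')).
(* The energy densities can differ only where the densities or the fluxes do: a union of two null
   sets. *)
move=> e eE; apply: negligibleS (negligibleU (rr e eE) (mm e eE)) => x /= nx.
apply: contrapT => /not_orP[/contrapT r /contrapT u]; apply: nx => xI.
by rewrite /P_net r// u.
Qed.

(** * Both identities, by integration in time *)

Theorem lemma4p3 (R : realType) (G : network R) (N : G * G -> nat)
    (a b c : G * G -> R) (gamma T : R) (rho0 m0 : edge_fun G)
    (rho m : R -> edge_fun G)
    (hN : forall e, e \in edges G -> (0 < N e)%N)
    (ha : forall e, e \in edges G -> 0 <= a e)
    (hb : forall e, e \in edges G -> 0 <= b e)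
    (hc : forall e, e \in edges G -> 0 < c e)
    (hgamma : 1 < gamma) (hT : 0 < T)
    (hrho0 : Qh N rho0) (hrho0_pos : positive rho0) (hm0 : Vh N m0)
    (hsol : semidiscrete_solution N a b c gamma T rho0 m0 rho m)
    (t : R) (ht : t \in `[0, T]) :
  int_net (rho t) = int_net rho0 /\
  energy c gamma (rho t) (m t)
    + \int[@lebesgue_measure R]_(s in `[0, t]) dissipation a b (rho s) (m s)
  = energy c gamma rho0 m0.
Proof.
case: hsol => drho [dm [[C1r C1m] pos [rho_init m_init] mass momentum]].
have zT : 0 \in `[0, T] by rewrite in_itv/= lexx ltW.
have sub s : s \in `[0, t] -> s \in `[0, T].
  by move: ht; rewrite !in_itv/= => /andP[_ tT] /andP[-> /le_trans->].
have Qr s : s \in `[0, T] -> Qh N (rho s) /\ Qh N (drho s) by move=> /C1r[].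
have Vm s : s \in `[0, T] -> Vh N (m s) /\ Vh N (dm s) by move=> /C1m[].
have Vh_affine u : Vh N u -> affine N u by case=> /(piecewise_affine hN).
have rC1 e i : e \in edges G -> (i < N e)%N ->
    primitive T (fun s => rho s e (midpoint N e i)) (fun s => drho s e (midpoint N e i)).
  move=> eE iN; apply: C1_function_primitive.
  by have [] := coefficients_C1 hN (Pk0_affine hN) C1r eE iN.
have mC1 e i : e \in edges G -> (i < N e)%N ->
    primitive T (fun s => m s e (midpoint N e i)) (fun s => dm s e (midpoint N e i)) /\
    primitive T (fun s => slope N (m s) e i) (fun s => slope N (dm s) e i).
  move=> eE iN; have [A B] := coefficients_C1 hN Vh_affine C1m eE iN.
  by split; exact: C1_function_primitive.
split.
  have <- : int_net (rho 0) = int_net rho0.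
    apply: (int_net_ae_eq hN _ (piecewise_const hN (Qr 0 zT).1)
      _ (piecewise_const hN hrho0) rho_init) => e i; continuity.
  have massE s : s \in `[0, T] -> int_net (rho s) = \sum_(e in edges G) \sum_(i < N e)
      meshsize N e * rho s e (midpoint N e i).
    move=> /Qr[Q _]; have := piecewise_const hN Q.
    exact: (int_net_const hN (k := fun e i => rho s e (midpoint N e i))).
  have prim : primitive T
      (fun s => \sum_(e in edges G) \sum_(i < N e) meshsize N e * rho s e (midpoint N e i))
      (fun s => \sum_(e in edges G) \sum_(i < N e) meshsize N e * drho s e (midpoint N e i)).
    apply: primitive_sum => e eE; apply: primitive_sum => i _.
    exact: primitiveZ (rC1 e i eE (ltn_ord i)).
  rewrite !massE//; apply/eqP; rewrite -subr_eq0; apply/eqP.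
  rewrite -(primitive_integral prim ht).
  (* The 0 on the right is written as the integral of the constant 0, to be compared with the mass
     rate at each time. *)
  rewrite -[RHS](mul0r (fine (lebesgue_measure `[0, t]%classic))) -Rintegral_cst//.
  apply: eq_Rintegral => s /set_mem /= /sub sT.
  by apply: (mass_balance hN) (mass s sT); [case: (Qr s sT)|case: (Vm s sT)].
rewrite -(energy_ae_eq c gamma hN (Qr 0 zT).1 hrho0
  (Vh_affine _ (Vm 0 zT).1) (Vh_affine _ hm0) rho_init m_init).
pose E s := \sum_(e in edges G) \sum_(i < N e)
  ((meshsize N e * m s e (midpoint N e i) ^+ 2
    + meshsize N e ^+ 3 / 12 * slope N (m s) e i ^+ 2) / (2 * rho s e (midpoint N e i))
   + meshsize N e * potential c gamma e (rho s e (midpoint N e i))).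
pose dE s := \sum_(e in edges G) \sum_(i < N e)
  energy_rate N c gamma e (rho s e (midpoint N e i)) (m s e (midpoint N e i))
    (slope N (m s) e i) (drho s e (midpoint N e i)) (dm s e (midpoint N e i))
    (slope N (dm s) e i).
have energyE s : s \in `[0, T] -> energy c gamma (rho s) (m s) = E s.
  by move=> sT; rewrite (energy_piecewise hN _ _ (Qr s sT).1 (Vh_affine _ (Vm s sT).1)).
have rateE s : s \in `[0, T] -> dE s = - dissipation a b (rho s) (m s).
  move=> sT; have [[Qrs Qdrs] [Vms Vdms]] := (Qr s sT, Vm s sT).
  exact: (energy_balance hN Qrs (pos s sT) Vms Qdrs Vdms (mass s sT) (momentum s sT)).
have prim : primitive T E dE.
  apply: primitive_sum => e eE; apply: primitive_sum => i _.
  have [A B] := mC1 e i eE (ltn_ord i).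
  apply: piece_energy_primitive (rC1 e i eE (ltn_ord i)) A B => s sT.
  by apply: (positive_midpoint hN) => //; [case: (Qr s sT)|exact: pos].
(* On [[0, t]] the dissipation is [-1 * dE], so [-1 * E] is a primitive of it and its continuity in
   time comes from that of [dE]. *)
have -> : \int[@lebesgue_measure R]_(s in `[0, t]) dissipation a b (rho s) (m s) =
    \int[@lebesgue_measure R]_(s in `[0, t]) (-1 * dE s).
  by apply: eq_Rintegral => s /set_mem /= /sub sT; rewrite rateE// mulN1r opprK.
by rewrite (primitive_integral (primitiveZ (-1) prim) ht) !energyE//; ring.
Qed.
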